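(* Let $A(t)$ be a geodesic on $\mathsf{SL}(2)$ with the HS metric. Then either $A(t)$ is unbounded, or $|A(t)|=\sqrt2$ for all $t$.
   Context: $\mathcal{M}(2)$ is the space of real $2\times 2$ matrices with the Hilbert-Schmidt inner product $\langle A,B\rangle=\operatorname{tr}(AB^T)$ and norm $|A|=\sqrt{\langle A,A\rangle}$. The HS metric on $\mathsf{SL}(2)=\{A\in\mathcal{M}(2):\det A=1\}$ is the Riemannian metric induced on it as a submanifold of the Euclidean space $\mathcal{M}(2)$. A curve $A(t)$ in $\mathsf{SL}(2)$ is a geodesic iff \[A''=\frac{\operatorname{tr}(A'A^{-1}A'A^{-1})}{\operatorname{tr}(A^{-1}A^{-T})}A^{-T}.\] This metric is geodesically complete, and geodesics are taken to be defined for all $t\in\mathbb{R}$.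
   Formalization: The geodesic is assumed nonconstant: a constant curve such as A(t) = diag(2, 1/2) satisfies the geodesic equation, is bounded, and has |A(t)| ≠ √2, so the claim fails for it. *)

(* Defs.v *)
From HB Require Import structures.
From mathcomp Require Import all_boot all_order all_algebra.
From mathcomp Require Import all_classical all_reals all_analysis.

Set Implicit Arguments.
Unset Strict Implicit.
Unset Printing Implicit Defensive.

Import Order.TTheory GRing.Theory Num.Theory.
Import numFieldNormedType.Exports.

Local Open Scope classical_set_scope.
Local Open Scope ring_scope.

Definition hs_inner (R : realType) (A B : 'M[R]_2) : R := \tr (A *m B^T).

(* Not to be confused with the canonical norm [`|A|] on ['M[R]_2], which is the
   sup norm of the entries. *)
Definition hs_norm (R : realType) (A : 'M[R]_2) : R := Num.sqrt (hs_inner A A).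

Definition SL2 (R : realType) : set 'M[R]_2 := [set A | \det A = 1].

(* The geodesic equation of the metric induced on SL(2) by the Hilbert-Schmidt
   inner product.  The derivatives are taken in the normed space ['M[R]_2];
   since all norms on it are equivalent, they are the entrywise derivatives.
   Constant curves satisfy this predicate. *)
Definition hs_geodesic (R : realType) (A : R -> 'M[R]_2) : Prop :=
  [/\ forall t, SL2 (A t),
      forall t, derivable A t 1,
      forall t, derivable (derive1 A) t 1
    & forall t,
        let A1 := derive1 A t in
        let A2 := derive1 (derive1 A) t in
        let B := invmx (A t) in
        A2 = (\tr (A1 *m B *m A1 *m B) / \tr (B *m B^T)) *: B^T].

Definition hs_unbounded (R : realType) (A : R -> 'M[R]_2) : Prop :=
  forall M : R, exists t : R, M < hs_norm (A t).

(* Main.v *)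
Require Import Defs.
From HB Require Import structures.
From mathcomp Require Import all_boot all_order all_algebra.
From mathcomp Require Import all_classical all_reals all_analysis.
From mathcomp Require Import ring lra.

Set Implicit Arguments.
Unset Strict Implicit.
Unset Printing Implicit Defensive.

Import Order.TTheory GRing.Theory Num.Theory.
Import numFieldNormedType.Exports.

Local Open Scope classical_set_scope.
Local Open Scope ring_scope.

(* The squared norm f = |A|^2 of a geodesic is convex.  In dimension two the
   acceleration is -2 det(A') / |A|^2 times A^{-T}, so
   f'' = 2 |A'|^2 - 8 det(A') / f, and 2 det <= |.|^2 gives
   f'' >= 2 |A'|^2 (1 - 2 / f) >= 0, because f >= 2 det(A) = 2.
   A bounded convex function on the line is constant; then f'' = 0, so that
   f = 2 at any time where A' does not vanish. *)

Lemma is_derive_nondecreasing (R : realType) (f f' : R -> R) :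
    (forall t : R, is_derive t 1 f (f' t)) -> (forall t, 0 <= f' t) ->
  {homo f : s t / s <= t}.
Proof.
move=> df f'_ge0 s t; rewrite le_eqVlt => /predU1P[->//|lt_st].
have cf : {within `[s, t], continuous f}.
  by apply: derivable_within_continuous => x _; have [] := df x.
have [c _ fE] := MVT lt_st (fun x _ => df x) cf.
by rewrite -subr_ge0 fE mulr_ge0 // subr_ge0 ltW.
Qed.

(** The mean value theorem turns the chord slope into [f' c] for some [c] between [s] and [t], and
    monotonicity of [f'] compares it with [f' t]. *)
Lemma convex_above_tangent (R : realType) (f f' f'' : R -> R)
    (df : forall t : R, is_derive t 1 f (f' t))
    (df' : forall t : R, is_derive t 1 f' (f'' t))
    (f''_ge0 : forall t, 0 <= f'' t) (s t : R) :
  f t + f' t * (s - t) <= f s.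
Proof.
have f'_incr := @is_derive_nondecreasing R f' f'' df' f''_ge0.
have cf (a b : R) : {within `[a, b], continuous f}.
  by apply: derivable_within_continuous => x _; have [] := df x.
have [lt_st|lt_ts|->] := ltgtP s t; last by rewrite subrr mulr0 addr0.
- have [c + fE] := MVT lt_st (fun x _ => df x) (cf s t).
  by rewrite in_itv /= => /andP[_ /ltW /f'_incr]; nra.
- have [c + fE] := MVT lt_ts (fun x _ => df x) (cf t s).
  by rewrite in_itv /= => /andP[/ltW /f'_incr + _]; nra.
Qed.

Lemma bounded_convex_derive0 (R : realType) (f f' f'' : R -> R) (M : R)
    (df : forall t : R, is_derive t 1 f (f' t))
    (df' : forall t : R, is_derive t 1 f' (f'' t))
    (f''_ge0 : forall t, 0 <= f'' t) (f_le : forall t, f t <= M) (t : R) :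
  f' t = 0.
Proof.
apply/eqP/negP => /negP f't_neq0.
(* The tangent line at [t] takes the value [M + 1] at this point, where [f] lies above it. *)
have := convex_above_tangent df df' f''_ge0 (t + (M + 1 - f t) / f' t) t.
rewrite addrAC subrr add0r mulrC divfK //.
by move: (f_le (t + (M + 1 - f t) / f' t)); lra.
Qed.

Lemma is_derive_mx_coord (R : realType) m n (A : R -> 'M[R]_(m, n)) (t : R) i j :
  derivable A t 1 -> is_derive t 1 (fun s => A s i j) (derive1 A t i j).
Proof.
move=> dA; rewrite derive1E derive_mx // mxE; apply: derivableP.
by move/derivable_mxP: dA.
Qed.

Lemma derive1_eq0_mx_cst (R : realType) m n (A : R -> 'M[R]_(m, n)) :
    (forall t, derivable A t 1) -> (forall t, derive1 A t = 0) ->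
  forall s t, A s = A t.
Proof.
move=> dA A'0 s t; apply/matrixP => i j.
apply: (@is_derive_0_is_cst _ (fun x => A x i j)) => x.
by have := is_derive_mx_coord i j (dA x); rewrite A'0 mxE.
Qed.

Lemma sum_ord2 (V : nmodType) (F : 'I_2 -> V) : \sum_i F i = F 0 + F 1.
Proof. by rewrite big_ord_recl big_ord1; congr (_ + F _); apply: val_inj. Qed.

Lemma det_mx22 (R : comRingType) (A : 'M[R]_2) :
  \det A = A 0 0 * A 1 1 - A 0 1 * A 1 0.
Proof.
rewrite (expand_det_row _ 0) sum_ord2 /cofactor !det_mx11 !mxE /=.
rewrite expr0 expr1 mul1r mulN1r mulrN.
by congr (_ * A _ _ - _ * A _ _); apply: val_inj.
Qed.

Lemma invmx22_SL (R : comUnitRingType) (A : 'M[R]_2) : \det A = 1 ->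
  [/\ invmx A 0 0 = A 1 1, invmx A 0 1 = - A 0 1,
      invmx A 1 0 = - A 1 0 & invmx A 1 1 = A 0 0].
Proof.
move=> detA; rewrite /invmx unitmxE detA unitr1 invr1 scale1r.
(* The minors are 1 x 1, so [lift] picks out the single remaining row and column. *)
have cof (i j k l : 'I_2) : lift j (0 : 'I_1) = k -> lift i (0 : 'I_1) = l ->
    \adj A i j = (-1) ^+ (j + i) * A k l.
  by move=> <- <-; rewrite mxE /cofactor det_mx11 !mxE.
have l0 : lift (0 : 'I_2) (0 : 'I_1) = 1 by apply: val_inj.
have l1 : lift (1 : 'I_2) (0 : 'I_1) = 0 by apply: val_inj.
split; rewrite ?(cof _ _ _ _ l0 l0) ?(cof _ _ _ _ l0 l1) ?(cof _ _ _ _ l1 l0)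
  ?(cof _ _ _ _ l1 l1) /= ?expr0 ?expr1 ?expr2 ?mulN1r ?opprK ?mul1r //.
Qed.

Lemma hs_inner22 (R : realType) (A B : 'M[R]_2) :
  hs_inner A B = A 0 0 * B 0 0 + A 0 1 * B 0 1 + A 1 0 * B 1 0 + A 1 1 * B 1 1.
Proof. by rewrite /hs_inner /mxtrace !(sum_ord2, mxE) !addrA. Qed.

Lemma hs_inner_ge0 (R : realType) (A : 'M[R]_2) : 0 <= hs_inner A A.
Proof. by rewrite hs_inner22 -!expr2 !addr_ge0 ?sqr_ge0. Qed.

Lemma hs_inner_eq0 (R : realType) (A : 'M[R]_2) : hs_inner A A = 0 -> A = 0.
Proof.
rewrite hs_inner22 -!expr2 => /eqP.
rewrite !paddr_eq0 ?addr_ge0 ?sqr_ge0 // !sqrf_eq0.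
move=> /andP[/andP[/andP[/eqP A00 /eqP A01] /eqP A10] /eqP A11].
have ord2P (i : 'I_2) : i = 0 \/ i = 1.
  by case: i => [[|[|//]] ?]; [left|right]; apply: val_inj.
by apply/matrixP => i j; rewrite mxE; have [->|->] := ord2P i; have [->|->] := ord2P j.
Qed.

(** The difference of the two sides is the sum of the squares of [A 0 0 - A 1 1] and
    [A 0 1 + A 1 0]. *)
Lemma det_le_hs_inner (R : realType) (A : 'M[R]_2) :
  2 * \det A <= hs_inner A A.
Proof.
rewrite hs_inner22 det_mx22.
have := sqr_ge0 (A 0 0 - A 1 1); have := sqr_ge0 (A 0 1 + A 1 0); nra.
Qed.

Lemma is_derive_hs_inner (R : realType) (A B : R -> 'M[R]_2) (t : R) :
    derivable A t 1 -> derivable B t 1 ->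
  is_derive t 1 (fun s => hs_inner (A s) (B s))
    (hs_inner (derive1 A t) (B t) + hs_inner (A t) (derive1 B t)).
Proof.
move=> dA dB.
have dAc i j := is_derive_mx_coord i j dA.
have dBc i j := is_derive_mx_coord i j dB.
under eq_fun do rewrite hs_inner22.
apply: is_derive_eq; rewrite !hs_inner22 /GRing.scale /=; ring.
Qed.

(** Differentiating [\det (A s) = 1] gives the tangency condition tr(A' A^{-1}) = 0, here written in
    entries. *)
Lemma SL2_tangent (R : realType) (A : R -> 'M[R]_2) (t : R) :
    (forall s, SL2 (A s)) -> derivable A t 1 ->
  derive1 A t 0 0 * A t 1 1 + A t 0 0 * derive1 A t 1 1
    = derive1 A t 0 1 * A t 1 0 + A t 0 1 * derive1 A t 1 0.
Proof.
move=> SLA dA; have dAc i j := is_derive_mx_coord i j dA.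
pose D := derive1 A t 0 0 * A t 1 1 + A t 0 0 * derive1 A t 1 1
    - (derive1 A t 0 1 * A t 1 0 + A t 0 1 * derive1 A t 1 0).
have dD : is_derive t 1 (fun s => \det (A s)) D.
  under eq_fun do rewrite det_mx22.
  apply: is_derive_eq; rewrite /D /GRing.scale /=; ring.
apply/eqP; rewrite -subr_eq0 -/D; apply/eqP.
have [_ <-] := dD.
rewrite (_ : (fun s => _) = cst 1) ?derive_cst //.
by apply/funext => s; exact: SLA.
Qed.

(** Three facts combine: tr((A' A^{-1})^2) = -2 det(A') for tangent A', |A^{-1}| = |A| because
    inversion only permutes entries up to sign, and the inner product of A with A^{-T} is tr(A
    A^{-1}) = 2. *)
Lemma SL2_acceleration (R : realType) (A A' : 'M[R]_2) (detA : \det A = 1)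
    (tgA : A' 0 0 * A 1 1 + A 0 0 * A' 1 1 = A' 0 1 * A 1 0 + A 0 1 * A' 1 0) :
  let B := invmx A in
  hs_inner A ((\tr (A' *m B *m A' *m B) / \tr (B *m B^T)) *: B^T)
    = - 4 * \det A' / hs_inner A A.
Proof.
have [B00 B01 B10 B11] := invmx22_SL detA.
move=> /=; set B := invmx A in B00 B01 B10 B11 *.
have trBB : \tr (B *m B^T) = hs_inner A A.
  rewrite -/(hs_inner B B) !hs_inner22 B00 B01 B10 B11; ring.
have trA'B : \tr (A' *m B *m A' *m B) = - 2 * \det A'.
  have := detA; rewrite /mxtrace !(sum_ord2, mxE) !det_mx22 B00 B01 B10 B11 => d.
  (* tr (X^2) = (tr X)^2 - 2 det X for X = A' A^{-1}, whose trace vanishes by [tgA]. *)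
  transitivity ((A' 0 0 * A 1 1 + A 0 0 * A' 1 1
      - (A' 0 1 * A 1 0 + A 0 1 * A' 1 0)) ^+ 2
    - 2 * (A' 0 0 * A' 1 1 - A' 0 1 * A' 1 0)
      * (A 0 0 * A 1 1 - A 0 1 * A 1 0)); first ring.
  by rewrite d tgA; ring.
have AB : hs_inner A B^T = 2.
  move: detA; rewrite hs_inner22 det_mx22 !mxE B00 B01 B10 B11 => detA; lra.
rewrite /hs_inner linearZ /= -scalemxAr mxtraceZ -/(hs_inner A B^T) AB trBB trA'B; ring.
Qed.

(** The right side is the second derivative of |A|^2 along a geodesic. The bound is kept as a
    product so that its vanishing forces A' = 0 or |A|^2 = 2. *)
Lemma geodesic_sqnorm_derive2_ge (R : realType) (A A' : 'M[R]_2) :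
  \det A = 1 ->
  2 * (hs_inner A' A' * (1 - 2 / hs_inner A A)) <=
    2 * (hs_inner A' A' + - 4 * \det A' / hs_inner A A).
Proof.
move=> detA.
have := det_le_hs_inner A; have := det_le_hs_inner A'; rewrite detA => h h1.
have N0 : 0 < hs_inner A A by lra.
have : 0 <= (hs_inner A A)^-1 by rewrite invr_ge0 ltW.
nra.
Qed.

(* As usual, geodesics are nonconstant: the claim fails for a constant curve at
   a point of norm other than sqrt 2. *)
Theorem theorem2p30 (R : realType) (A : R -> 'M[R]_2)
    (geoA : hs_geodesic A) (nonconstA : exists s t : R, A s <> A t) :
  hs_unbounded A \/ (forall t : R, hs_norm (A t) = Num.sqrt 2).
Proof.
have [SLA dA dA' eqA] := geoA.
pose N (t : R) : R := hs_inner (A t) (A t); pose A' := derive1 A.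
have [?|/existsNP[M /forallNP bndA]] := pselect (hs_unbounded A); first by left.
(* The bound [M] dominates a norm, hence is nonnegative and may be squared. *)
right; have N_le t : N t <= M ^+ 2.
  have /negP := bndA t; rewrite -leNgt => AtM.
  rewrite /N -(sqr_sqrtr (hs_inner_ge0 (A t))).
  by rewrite ler_sqr ?nnegrE ?(le_trans _ AtM) ?sqrtr_ge0.
pose N' (t : R) : R := 2 * hs_inner (A t) (A' t).
(* Half of this is |A'|^2 plus the inner product of A with A'', the latter rewritten by the geodesic
   equation. *)
pose N'' (t : R) : R := 2 * (hs_inner (A' t) (A' t) + - 4 * \det (A' t) / N t).
have dN (t : R) : is_derive t 1 N (N' t).
  apply: (is_derive_eq (is_derive_hs_inner (dA t) (dA t))).
  by rewrite /N' !hs_inner22; ring.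
have dN' (t : R) : is_derive t 1 N' (N'' t).
  have dAA' := is_derive_hs_inner (dA t) (dA' t).
  apply: (is_derive_eq (is_deriveZ 2 dAA')).
  by rewrite eqA SL2_acceleration; [ | exact: SLA | exact: SL2_tangent].
have N_ge2 t : 2 <= N t by have := det_le_hs_inner (A t); rewrite SLA mulr1.
have N''_ge t : 2 * (hs_inner (A' t) (A' t) * (1 - 2 / N t)) <= N'' t.
  exact/geodesic_sqnorm_derive2_ge/SLA.
have lower_ge0 t : 0 <= hs_inner (A' t) (A' t) * (1 - 2 / N t).
  rewrite mulr_ge0 ?hs_inner_ge0 // subr_ge0 ler_pdivrMr ?mul1r //.
  by rewrite (lt_le_trans _ (N_ge2 t)).
have N''_ge0 t : 0 <= N'' t by have := N''_ge t; have := lower_ge0 t; lra.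
have N'0 := bounded_convex_derive0 dN dN' N''_ge0 N_le.
have N''0 t : N'' t = 0.
  have [_ <-] := dN' t.
  by rewrite (_ : N' = cst 0) ?derive_cst //; apply/funext.
have Ncst s t : N s = N t.
  by apply: is_derive_0_is_cst => x; rewrite -(N'0 x).
(* Nonconstancy enters here: a curve with zero velocity everywhere is constant. *)
have [t0 A't0] : exists t, A' t != 0.
  apply: contrapT => /forallNP A'0; have [s [t]] := nonconstA; apply.
  by apply: derive1_eq0_mx_cst => // x; apply/eqP; have /negP := A'0 x; rewrite negbK.
suff N2 : N t0 = 2 by move=> t; rewrite /hs_norm -/(N t) (Ncst t t0) N2.
have NA' : hs_inner (A' t0) (A' t0) != 0 by apply: contra_neq A't0; exact: hs_inner_eq0.
(* The product is squeezed between 0 and [N'' t0 = 0]; as the velocity at [t0] is nonzero, the other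
   factor vanishes. *)
have : hs_inner (A' t0) (A' t0) * (1 - 2 / N t0) == 0.
  by rewrite eq_le lower_ge0 andbT; have := N''_ge t0; rewrite N''0; lra.
rewrite mulf_eq0 (negbTE NA') /= subr_eq0 => /eqP e.
have N0 : N t0 != 0 by rewrite gt_eqF // (lt_le_trans _ (N_ge2 t0)).
by apply: (mulIf (invr_neq0 N0)); rewrite divff.
Qed.
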